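(* For all types $\sigma,\tau\Vdash n$, the coefficient of $p_{\tau}^{\otimes}$ in the $p^{\otimes}$-expansion of $H_{\sigma}$ is \[ \mathcal{M}(H,p^{\otimes})_{\tau,\sigma}=\sum_{T\in\mathrm{ICRHT}(\tau,\sigma)} \operatorname{wt}(T). \]
   Context: An integer partition is a finite (possibly empty) weakly decreasing sequence of positive integers; $m_i(\lambda)$ is the number of parts of $\lambda$ equal to $i$, and $z_\lambda=\prod_{i\ge1}i^{m_i(\lambda)}m_i(\lambda)!$. A block is an ordered pair of positive integers written $d^m$ (degree $d$, multiplicity $m$). Blocks are ordered by $a^b\ge d^e$ iff $a>d$, or $a=d$ and $b\ge e$. A type is a finite (possibly empty) weakly decreasing sequence of blocks $\tau=(a_1^{b_1},\dots,a_t^{b_t})$; $\tau\Vdash n$ means $\sum_ia_ib_i=n$. For $k\ge1$, $\tau|_k$ denotes the integer partition formed by the multiplicities of the blocks of $\tau$ of degree $k$; the type $\tau$ is determined by $(\tau|_k)_{k\ge1}$. Put $z^\otimes_\tau=\prod_{k\ge1}z_{\tau|_k}$. The tensor diagram of $\tau$ is the sequence of partition diagrams $\mathrm{dg}(\tau|_1)\otimes\mathrm{dg}(\tau|_2)\otimes\cdots$; the $k$th component has rows (left-justified, longest at top) of lengths the parts of $\tau|_k$. Variables: $x_{k,j}$ for $k,j\ge 1$, with $\deg x_{k,j}=k$; $\mathbf{x}_{k*}=(x_{k,1},x_{k,2},\dots)$. The graded algebra $\mathsf{P\Lambda}=\bigoplus_n\mathsf{P\Lambda}^n$ of polysymmetric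 functions consists of the formal series over $\mathbb{Q}$ of bounded degree in all the $x_{k,j}$ that, for each fixed $k$, are unchanged by any permutation of the variables $\mathbf{x}_{k*}$. Define $p^{\otimes}_\tau=\prod_{k\ge1}p_{\tau|_k}(\mathbf{x}_{k*})$, where $p_\lambda$ is the power-sum symmetric function; $\{p^\otimes_\tau:\tau\Vdash n\}$ is a basis of $\mathsf{P\Lambda}^n$. $H_d$ is the sum of all distinct monomials of degree $d$ in the variables $x_{k,j}$ (with $\deg x_{k,j}=k$), $H_{d^m}$ is obtained from $H_d$ by replacing every variable $x_{k,j}$ by $x_{k,j}^m$, and $H_\sigma=\prod_{i=1}^sH_{d_i^{m_i}}$ for $\sigma=(d_1^{m_1},\dots,d_s^{m_s})$. The transition matrix is defined by $H_\sigma=\sum_{\tau\Vdash n}\mathcal{M}(H,p^\otimes)_{\tau,\sigma}p^\otimes_\tau$ for $\sigma\Vdash n$. For $\sigma=(d_1^{m_1},\dots,d_s^{m_s})$, $\mathrm{ICRHT}(\tau,\sigma)$ is the set of increasing constant-row $H$-tableaux of shape $\tau$ and content $\sigma$: fillings $T$ of the cells of the tensor diagram of $\tau$ with integers $1,\dots,s$ such that: (i) each row of each component is constant; (ii) for $1\le i\le s$, the cells containing $i$ form a sub-tensor diagram equal to $\mathrm{dg}(m_i\rho^{(i)})$ for some type $\rho^{(i)}\Vdash d_i$, i.e., for each $k$ the multiset of lengths of the rows of component $k$ filled with $i$ is the multiset of parts of $\rho^{(i)}|_k$ each multiplied by $m_i$; (iii) for each $r,k$, the values in the rows of length $r$ in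 component $k$ weakly increase reading down the first column. The weight is $\operatorname{wt}(T)=\prod_{i=1}^s1/z^\otimes_{\rho^{(i)}}$. *)

(* Defs.v *)
From HB Require Import structures.
From mathcomp Require Import all_boot all_order all_algebra.
From mathcomp Require Import finmap.
From mathcomp Require Import mathcomp_extra boolp classical_sets functions.
From mathcomp Require Import cardinality fsbigop.
From mathcomp.multinomials Require Import monalg.

Set Implicit Arguments.
Unset Strict Implicit.
Unset Printing Implicit Defensive.

Import GRing.Theory.
Local Open Scope ring_scope.

(* The index (k, j) stands for the variable x_{k,j}. *)
Definition posint := {n : nat | (0 < n)%N}.
Definition var : choiceType := (posint * posint)%type.
Definition mono : choiceType := {cmonom var}.

Definition degm (m : mono) : nat := (\sum_(v <- finsupp m) val v.1 * m v)%N.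

(* Formal series over rat in all the variables x_{k,j}, given by their
   coefficients. *)
Record series := Series { coef : mono -> rat }.

Lemma seriesP (f g : series) : (forall m, coef f m = coef g m) -> f = g.
Proof. by case: f; case: g => f g /= /funext ->. Qed.

HB.instance Definition _ := gen_eqMixin series.
HB.instance Definition _ := gen_choiceMixin series.

Definition series_zero := Series (fun=> 0).
Definition series_opp f := Series (fun m => - coef f m).
Definition series_add f g := Series (fun m => coef f m + coef g m).

Lemma series_addA : associative series_add.
Proof. by move=> f g h; apply: seriesP => m /=; rewrite addrA. Qed.
Lemma series_addC : commutative series_add.
Proof. by move=> f g; apply: seriesP => m /=; rewrite addrC. Qed.
Lemma series_add0 : left_id series_zero series_add.
Proof. by move=> f; apply: seriesP => m /=; rewrite add0r. Qed.
Lemma series_addN : left_inverse series_zero series_opp series_add.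
Proof. by move=> f; apply: seriesP => m /=; rewrite addNr. Qed.

HB.instance Definition _ := GRing.isZmodule.Build series
  series_addA series_addC series_add0 series_addN.

Definition series_scale (a : rat) f := Series (fun m => a * coef f m).

Lemma series_scaleA a b v :
  series_scale a (series_scale b v) = series_scale (a * b) v.
Proof. by apply: seriesP => m /=; rewrite mulrA. Qed.
Lemma series_scale1 : left_id 1 series_scale.
Proof. by move=> f; apply: seriesP => m /=; rewrite mul1r. Qed.
Lemma series_scaleDr : right_distributive series_scale +%R.
Proof. by move=> a f g; apply: seriesP => m /=; rewrite mulrDr. Qed.
Lemma series_scaleDl v : {morph series_scale^~ v : a b / a + b}.
Proof. by move=> a b; apply: seriesP => m /=; rewrite mulrDl. Qed.

HB.instance Definition _ := GRing.Zmodule_isLmodule.Build rat series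
  series_scaleA series_scale1 series_scaleDr series_scaleDl.

Definition series_one := Series (fun m => (m == onecm _)%:R).

Definition series_mul f g := Series (fun m =>
  \sum_(ab \in [set ab : mono * mono | mulcm ab.1 ab.2 = m]%classic)
     coef f ab.1 * coef g ab.2).

Definition mdivs (m : mono) : seq mono :=
  undup [seq [cmonom (u i : nat) | i : finsupp m]%M
        | u : {ffun finsupp m -> 'I_(mdeg m).+1}].

Lemma mdivs_uniq m : uniq (mdivs m).
Proof. exact: undup_uniq. Qed.

Lemma mem_mdivsl (m a b : mono) : mulcm a b = m -> a \in mdivs m.
Proof.
move=> abm; have le i : (a i <= m i)%N by rewrite -abm mulcmE leq_addr.
rewrite mem_undup; apply/mapP.
exists [ffun i : finsupp m => inord (a (val i))]; first by rewrite mem_enum.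
apply/eqP/cmP => i; rewrite cmE /= fsfun_ffun; case: insubP => [j _ <-|].
  rewrite /= ffunE inordK // ltnS (leq_trans (le _)) // /mdeg.
  by rewrite (big_fsetD1 (val j)) ?fsvalP //= leq_addr.
by rewrite -cmE_eq0 => /eqP mi; move: (le i); rewrite mi leqn0 => /eqP.
Qed.

Lemma mem_mdivsr (m a b : mono) : mulcm a b = m -> b \in mdivs m.
Proof. by rewrite mulcmC; apply: mem_mdivsl. Qed.

(* The Cauchy product computed on any finite set of monomials that contains all
   the divisors of m. *)
Lemma coef_mulE (D : seq mono) (f g : series) (m : mono) : uniq D ->
    (forall a b, mulcm a b = m -> a \in D /\ b \in D) ->
  coef (series_mul f g) m =
  \sum_(a <- D) \sum_(b <- D) (mulcm a b == m)%:R * (coef f a * coef g b).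
Proof.
move=> uD divD /=.
have uDD : uniq [seq (a, b) | a <- D, b <- D].
  by apply: allpairs_uniq => // -[a b] [c d] _ _ [-> ->].
rewrite (fsbigE [seq ab <- [seq (a, b) | a <- D, b <- D]
                | mulcm ab.1 ab.2 == m]).
- rewrite big_filter_cond; under [LHS]eq_bigl => ab.
    rewrite (_ : _ && _ = (mulcm ab.1 ab.2 == m)); last first.
      by apply/andP/idP => [[]//|/eqP e]; split; [apply/eqP|rewrite inE].
    over.
  rewrite big_mkcond big_allpairs /=; apply: eq_bigr => a _.
  by apply: eq_bigr => b _; case: ifP; rewrite ?mul1r ?mul0r.
- exact: filter_uniq.
- by move=> ab /=; rewrite mem_filter => /andP[/eqP].
- move=> [a b] /= abm; have [aD bD] := divD _ _ abm.
  by rewrite mem_filter /= abm eqxx /= (allpairs_f _ aD bD).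
Qed.

Lemma coef_mulE_mdivs (f g : series) (m : mono) :
  coef (series_mul f g) m =
  \sum_(a <- mdivs m) \sum_(b <- mdivs m)
     (mulcm a b == m)%:R * (coef f a * coef g b).
Proof.
apply: coef_mulE => [|a b abm]; first exact: mdivs_uniq.
by split; [apply: mem_mdivsl abm|apply: mem_mdivsr abm].
Qed.

Lemma series_mulC : commutative series_mul.
Proof.
move=> f g; apply: seriesP => m; rewrite !coef_mulE_mdivs exchange_big /=.
apply: eq_bigr => b _; apply: eq_bigr => a _.
by rewrite mulcmC [coef f _ * _]mulrC.
Qed.

Lemma series_mulDl : left_distributive series_mul +%R.
Proof.
move=> f g h; apply: seriesP => m.
rewrite [RHS]/= -/(series_mul f h) -/(series_mul g h).
rewrite -[X in _ = X + _]/(coef (series_mul f h) m).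
rewrite -[X in _ = _ + X]/(coef (series_mul g h) m).
rewrite !coef_mulE_mdivs -big_split; apply: eq_bigr => a _ /=.
by rewrite -big_split; apply: eq_bigr => b _ /=; rewrite mulrDl mulrDr.
Qed.

Lemma series_mul1 : left_id series_one series_mul.
Proof.
move=> f; apply: seriesP => m; rewrite coef_mulE_mdivs.
have d1 : onecm var \in mdivs m by apply: (@mem_mdivsl _ _ m); rewrite mul0cm.
have dm : m \in mdivs m by apply: (@mem_mdivsl _ _ (onecm _)); rewrite mulcm0.
rewrite (bigD1_seq (onecm _)) ?mdivs_uniq //=.
rewrite [X in _ + X]big1 => [|a /negPf na].
  rewrite addr0 (bigD1_seq m) ?mdivs_uniq //=.
  rewrite [X in _ + X]big1 => [|b /negPf nb].
    by rewrite mul0cm !eqxx !mul1r addr0.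
  by rewrite mul0cm nb mul0r.
by rewrite big1 // => b _; rewrite na mul0r mulr0.
Qed.

Lemma series_mulA : associative series_mul.
Proof.
have key (f g h : series) m : coef (series_mul f (series_mul g h)) m =
    \sum_(a <- mdivs m) \sum_(c <- mdivs m) \sum_(e <- mdivs m)
      (mulcm a (mulcm c e) == m)%:R * (coef f a * (coef g c * coef h e)).
  rewrite coef_mulE_mdivs; apply: eq_bigr => a _.
  transitivity (\sum_(b <- mdivs m) \sum_(c <- mdivs m) \sum_(e <- mdivs m)
      ((mulcm a b == m) && (mulcm c e == b))%:R *
      (coef f a * (coef g c * coef h e))).
    apply: eq_bigr => b _; case: eqP => [abm|_]; last first.
      rewrite mul0r big1 // => c _; rewrite big1 // => e _.
      by rewrite andFb mul0r.
    rewrite mul1r (@coef_mulE (mdivs m)) ?mdivs_uniq //; last first.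
      move=> c e ceb; split.
        by apply: (@mem_mdivsl _ _ (mulcm e a)); rewrite mulcmA ceb mulcmC.
      apply: (@mem_mdivsl _ _ (mulcm c a)).
      by rewrite mulcmA (mulcmC e) ceb mulcmC.
    rewrite mulr_sumr; apply: eq_bigr => c _.
    by rewrite mulr_sumr; apply: eq_bigr => e _; rewrite andTb mulrCA.
  rewrite exchange_big; apply: eq_bigr => c _.
  rewrite exchange_big; apply: eq_bigr => e _ /=.
  rewrite -mulr_suml; congr (_ * _); case: eqP => [acem|nacem].
    rewrite (bigD1_seq (mulcm c e)) ?mdivs_uniq ?(mem_mdivsr acem) //=.
    rewrite acem !eqxx.
    rewrite big1 ?addr0 // => b /negPf nb.
    by rewrite [_ == b]eq_sym nb andbF.
  rewrite big1 // => b _; case: (mulcm c e =P b) => [<-|]; rewrite ?andbF //.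
  by case: eqP.
move=> f g h; apply: seriesP => m.
rewrite [series_mul (series_mul f g) h]series_mulC !key [RHS]exchange_big /=.
apply: eq_bigr => a _; rewrite [RHS]exchange_big /=.
apply: eq_bigr => c _; apply: eq_bigr => e _.
rewrite [mulcm e _]mulcmC mulcmA [coef h e * _]mulrC.
by rewrite [coef f a * (_ * _)]mulrA.
Qed.

Lemma series_oner_neq0 : series_one != 0.
Proof.
apply/eqP => /(congr1 (fun f => coef f (onecm _))) /= /eqP.
by rewrite eqxx oner_eq0.
Qed.

HB.instance Definition _ := GRing.Zmodule_isComNzRing.Build series
  series_mulA series_mulC series_mul1 series_mulDl series_oner_neq0.

(* Factors with i > sumn la are 1. *)
Definition zpart (la : seq nat) : nat :=
  (\prod_(1 <= i < (sumn la).+1) (i ^ count_mem i la * (count_mem i la)`!))%N.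

(* The pair (d, m) is the block d^m. *)
Definition block := (nat * nat)%type.

Definition block_ge (b c : block) : bool :=
  (c.1 < b.1)%N || (b.1 == c.1) && (c.2 <= b.2)%N.

Definition is_type (tau : seq block) : bool :=
  sorted block_ge tau && all (fun b => (0 < b.1)%N && (0 < b.2)%N) tau.

Definition weight (tau : seq block) : nat := (\sum_(b <- tau) b.1 * b.2)%N.

Definition type_of (n : nat) (tau : seq block) : bool :=
  is_type tau && (weight tau == n).

(* tau|_k; for a type tau this list is already weakly decreasing, and it is
   empty unless 1 <= k <= weight tau, which is why the products over all k >= 1
   below stop at weight tau. *)
Definition component (tau : seq block) (k : nat) : seq nat :=
  [seq b.2 | b <- tau & b.1 == k].

Definition ztens (tau : seq block) : nat :=
  (\prod_(1 <= k < (weight tau).+1) zpart (component tau k))%N.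

(* p_r(x_{k*}) = \sum_(j >= 1) x_{k,j} ^ r, for r >= 1 *)
Definition psum (k r : nat) : series := Series (fun m =>
  `[< exists v : var, val v.1 = k /\ m = expcmn (ucm v) r >]%:R).

Definition ptens (tau : seq block) : series :=
  \prod_(1 <= k < (weight tau).+1) \prod_(r <- component tau k) psum k r.

Definition Hdeg (d : nat) : series := Series (fun m => (degm m == d)%:R).

(* The series obtained from f by replacing every variable x by x ^ e, e >= 1. *)
Definition subst_pow (e : nat) (f : series) : series := Series (fun m =>
  \sum_(u \in [set u : mono | expcmn u e = m]%classic) coef f u).

Definition Htype (sigma : seq block) : series :=
  \prod_(b <- sigma) subst_pow b.2 (Hdeg b.1).

Definition is_pexpansion (n : nat) (f : series) (c : seq block -> rat) : Prop :=
  f = \sum_(tau \in [set tau | type_of n tau]%classic) c tau *: ptens tau.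

(* The coefficient of p_tau in the expansion of H_sigma in the p_tau with tau a
   type of n. These p_tau being linearly independent, c is unique on types
   of n; its values elsewhere are irrelevant. *)
Definition transHp (n : nat) (tau sigma : seq block) : rat :=
  xget (fun=> 0) [set c | is_pexpansion n (Htype sigma) c]%classic tau.

(* The cell in row r and column c of component k is ((k, r), c); rows and
   columns are numbered from 0. *)
Definition cell := (nat * nat * nat)%type.

Definition row_len (tau : seq block) (kr : nat * nat) : nat :=
  nth 0 (component tau kr.1) kr.2.

Definition tdiagram (tau : seq block) : seq cell :=
  [seq (kr, c) | kr <- [seq (k, r) | k <- iota 1 (weight tau),
                                     r <- iota 0 (size (component tau k))],
                 c <- iota 0 (row_len tau kr)].

(* The entries 1, ..., s are represented by 0, ..., s - 1. *)
Definition filling (tau sigma : seq block) : finType :=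
  {ffun seq_sub (tdiagram tau) -> 'I_(size sigma)}.

Section Tableaux.
Variables tau sigma : seq block.
Implicit Types (T : filling tau sigma) (x y : seq_sub (tdiagram tau)).

Definition row_of x : nat * nat := (val x).1.
Definition col_of x : nat := (val x).2.

Definition constant_rows T : bool :=
  [forall x, forall y, (row_of x == row_of y) ==> (T x == T y)].

(* The lengths of the rows of component k filled with i. *)
Definition filled_rows T (i : 'I_(size sigma)) (k : nat) : seq nat :=
  [seq row_len tau (k, r) | r <- iota 0 (size (component tau k))
     & [forall x, (row_of x == (k, r)) ==> (T x == i)]].

(* The cells of T filled with i form dg(m_i rho), where rho is a type of d_i. *)
Definition content T (i : 'I_(size sigma)) (rho : seq block) : Prop :=
  let b := tnth (in_tuple sigma) i in
  type_of b.1 rho /\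
  forall k, (0 < k)%N ->
    perm_eq (filled_rows T i k) [seq (b.2 * l)%N | l <- component rho k].

Definition increasing T : bool :=
  [forall x, forall y,
    [&& (row_of x).1 == (row_of y).1,
        row_len tau (row_of x) == row_len tau (row_of y),
        ((row_of x).2 <= (row_of y).2)%N, col_of x == 0 & col_of y == 0]
    ==> (T x <= T y)%N].

Definition ICRHT : {set filling tau sigma} :=
  [set T | [&& constant_rows T, `[< forall i, exists rho, content T i rho >]
             & increasing T]]%SET.

(* The type rho^(i), which is determined by T and i when T is in ICRHT. *)
Definition content_type T (i : 'I_(size sigma)) : seq block :=
  xget [::] [set rho | content T i rho]%classic.

Definition wt T : rat :=
  \prod_(i < size sigma) (1 / (ztens (content_type T i))%:R).

End Tableaux.

(* Main.v *)
Require Import Defs.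
From HB Require Import structures.
From mathcomp Require Import all_boot all_order all_algebra.
From mathcomp Require Import finmap.
From mathcomp Require Import boolp classical_sets fsbigop.
From mathcomp.multinomials Require Import monalg.
From mathcomp Require Import zify ring.
Import GRing.Theory.
Local Open Scope ring_scope.

Set Implicit Arguments.
Unset Strict Implicit.
Unset Printing Implicit Defensive.

(** Logarithmic differentiation of the product of all 1 / (1 - x_{k,j}) says
    that the H_d are exponential in the power sums; comparing coefficients,
        H_d = sum over the types rho of weight d of p_rho / z_rho.
    Rather than manipulating the logarithm, the proof compares two solutions
    of one recursion in d,
        d H_d = sum over the blocks k^l with k l <= d of k p_{k,l} H_{d - k l}.
    For H_d it counts, for a monomial of degree d, the ways of splitting off a
    power of one variable ([Hpow_rec]); for the sum over types it says that
    removing a block k^l from rho divides z_rho by l times the multiplicity of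
    the block ([expsum_rec]).  Replacing every variable by its e-th power turns
    p_{k,l} into p_{k,e l}; since the recursion for H_{d^e} can be read off the
    coefficients in the same way, both are treated at once ([Hpow_expsum]).

    Expanding the product H_sigma then chooses one type rho_i of weight d_i for
    each block d_i^{m_i} of sigma, and the chosen term is a multiple of p_tau
    exactly when the types rho_i, with multiplicities scaled by m_i, together
    have the blocks of tau ([Htype_assignments]).  The p_tau being linearly
    independent ([ptens_free]), the coefficient of p_tau is the sum of the
    products of the 1 / z_{rho_i} over these choices ([transHpE]).

    Finally these choices are the tableaux ([sum_tableaux]).  The content of a
    tableau is such a choice; conversely the choice prescribes how many of the
    rows of each length in each component are filled with each i, and since
    the labels of these rows weakly increase, the counts determine them. *)

(** * Types *)

Definition positive_block (b : block) := (0 < b.1)%N && (0 < b.2)%N.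

Definition block_size (b : block) : nat := (b.1 * b.2)%N.

Lemma block_ge_total : total block_ge.
Proof.
case=> a b [c d]; rewrite /block_ge /=.
by case: ltngtP => //= _; apply: leq_total.
Qed.

Lemma block_ge_trans : transitive block_ge.
Proof.
case=> a b [c d] [e f]; rewrite /block_ge /= => h1 h2.
case: (ltngtP a c) h1 h2 => //= [ac _|<- bd].
  case: (ltngtP e a) => //= [ea _|-> _]; last by rewrite ac.
  by rewrite (ltn_trans ea ac).
by case: (ltngtP e a) => //= _ /leq_trans; apply.
Qed.

Lemma block_ge_anti : antisymmetric block_ge.
Proof.
case=> a b [c d]; rewrite /block_ge /=.
by case: ltngtP => //= -> /anti_leq ->.
Qed.

Lemma weight_cons b s : weight (b :: s) = (block_size b + weight s)%N.
Proof. by rewrite /weight big_cons. Qed.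

Lemma weight_perm s t : perm_eq s t -> weight s = weight t.
Proof. exact: perm_big. Qed.

Lemma leq_block_size s b : b \in s -> (block_size b <= weight s)%N.
Proof. by move=> bs; rewrite (weight_perm (perm_to_rem bs)) weight_cons leq_addr. Qed.

(** Inserting a block or collecting the blocks of several types destroys the
    order, and is therefore followed by sorting. *)
Lemma type_of_sort n s :
  type_of n (sort block_ge s) = all positive_block s && (weight s == n).
Proof.
rewrite /type_of /is_type (sort_sorted block_ge_total) /=.
by rewrite all_sort (weight_perm (permEl (perm_sort _ _))).
Qed.

Lemma type_of_positive n s : type_of n s -> all positive_block s.
Proof. by case/andP=> /andP[]. Qed.

Lemma type_of_weight n s : type_of n s -> weight s = n.
Proof. by case/andP=> _ /eqP. Qed.

Lemma type_of_sorted n s : type_of n s -> sorted block_ge s.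
Proof. by case/andP=> /andP[]. Qed.

Lemma type_of_inj m n s t : type_of m s -> type_of n t -> perm_eq s t -> s = t.
Proof.
move=> /type_of_sorted hs /type_of_sorted ht.
exact: (sorted_eq block_ge_trans block_ge_anti).
Qed.

Lemma sort_type n s : type_of n s -> sort block_ge s = s.
Proof. by move=> /type_of_sorted; apply: (sorted_sort block_ge_trans). Qed.

Lemma positive_block_le b :
  positive_block b -> (b.1 <= block_size b)%N && (b.2 <= block_size b)%N.
Proof. by case/andP=> b1 b2; rewrite leq_pmulr // leq_pmull. Qed.

(** * Enumerating types *)

(** A finite range of blocks that contains all the blocks of all the types of
    weight at most n; sums and products over k >= 1 and l >= 1 are cut off to
    it. *)
Definition blocks (n : nat) : seq block :=
  [seq (k, l) | k <- index_iota 1 n.+1, l <- index_iota 1 n.+1].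

Lemma blocks_uniq n : uniq (blocks n).
Proof. by apply: allpairs_uniq; rewrite ?iota_uniq // => -[a b] [c d]. Qed.

Lemma mem_blocks n b :
  (b \in blocks n) = [&& positive_block b, (b.1 <= n)%N & (b.2 <= n)%N].
Proof.
case: b => k l; apply/allpairsP/idP => [[p /= [kp lp [-> ->]]]|].
  move: kp lp; rewrite !mem_index_iota !ltnS => /andP[p1 ?] /andP[p2 ?].
  by rewrite /positive_block /= p1 p2 /=; apply/andP.
case/and3P=> /andP[? ?] ? ?; exists (k, l).
by split=> //=; rewrite mem_index_iota ltnS; apply/andP.
Qed.

Lemma type_of_blocks n N s b : type_of n s -> (n <= N)%N -> b \in s -> b \in blocks N.
Proof.
move=> hs nN bs; have pb := allP (type_of_positive hs) _ bs.
have /andP[b1 b2] := positive_block_le pb.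
have sN : (block_size b <= N)%N.
  by apply: leq_trans nN; rewrite -(type_of_weight hs) leq_block_size.
by rewrite mem_blocks pb (leq_trans b1) // (leq_trans b2).
Qed.

Fixpoint words (T : Type) (A : seq T) (k : nat) : seq (seq T) :=
  if k is k'.+1 then [::] :: [seq a :: w | a <- A, w <- words A k'] else [:: [::]].

Lemma mem_words (T : eqType) (A : seq T) k w :
  (size w <= k)%N -> {subset w <= A} -> w \in words A k.
Proof.
elim: k w => [|k IH] [|a w] //= wk sA; rewrite in_cons /=.
apply/allpairsP; exists (a, w); split => //=.
  by apply: sA; rewrite mem_head.
by apply: IH => // b bw; apply: sA; rewrite in_cons bw orbT.
Qed.

Definition types (n : nat) : seq (seq block) :=
  undup [seq s <- words (blocks n) n | type_of n s].

Lemma types_uniq n : uniq (types n).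
Proof. exact: undup_uniq. Qed.

Lemma size_le_weight s : all positive_block s -> (size s <= weight s)%N.
Proof.
elim: s => //= b s IH /andP[/andP[b1 b2] /IH ws].
by rewrite weight_cons -add1n leq_add // muln_gt0 b1.
Qed.

Lemma mem_types n s : (s \in types n) = type_of n s.
Proof.
rewrite mem_undup mem_filter; case: (boolP (type_of n s)) => //= hs.
apply: mem_words => [|b bs]; last exact: type_of_blocks hs (leqnn n) bs.
by rewrite -[leqRHS](type_of_weight hs) size_le_weight // (type_of_positive hs).
Qed.

(** * The factors z *)

(** The number z of a type as a single product over blocks, cut off at an N
    that can be shared by types of different weights. *)
Definition zblocks (N : nat) (s : seq block) : nat :=
  (\prod_(b <- blocks N) (b.2 ^ count_mem b s * (count_mem b s)`!))%N.

Lemma count_component s k l : count_mem l (component s k) = count_mem (k, l) s.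
Proof.
rewrite /component count_map count_filter; apply: eq_count => -[a b] /=.
by rewrite xpair_eqE andbC.
Qed.

Lemma ztensE n N s : type_of n s -> (n <= N)%N -> ztens s = zblocks N s.
Proof.
move=> hs nN; rewrite /zblocks big_allpairs /= /ztens (type_of_weight hs).
have notin k l : (n < k)%N || (n < l)%N -> count_mem (k, l) s = 0%N.
  move=> kl; apply: count_memPn; apply/negP => /(type_of_blocks hs (leqnn n)).
  by rewrite mem_blocks => /and3P[_ /= kn ln]; move: kl; rewrite !ltnNge kn ln.
rewrite [RHS](big_cat_nat (n := n.+1)) //= [X in (_ * X)%N]big_nat.
rewrite [X in (_ * X)%N]big1 ?muln1 => [|k /andP[nk _]]; last first.
  by rewrite big1 // => l _; rewrite notin ?nk.
apply: eq_bigr => k _; rewrite /zpart.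
have le : (sumn (component s k) <= n)%N.
  rewrite -(type_of_weight hs) /weight sumnE big_map big_filter big_mkcond.
  rewrite big_seq [leqRHS]big_seq; apply: leq_sum => b bs; case: ifP => // _.
  by have /andP[] := positive_block_le (allP (type_of_positive hs) _ bs).
under eq_bigr do rewrite count_component.
rewrite [RHS](big_cat_nat (n := (sumn (component s k)).+1)) //=; last first.
  by rewrite ltnS (leq_trans le).
rewrite [X in (_ * X)%N]big_nat [X in (_ * X)%N]big1 ?muln1 // => l /andP[lk _].
rewrite -count_component (count_memPn _) //; apply/negP => lin.
by move: lk; rewrite ltnNge (perm_sumn (perm_to_rem lin)) leq_addr.
Qed.

Lemma zblocks_perm N s t : perm_eq s t -> zblocks N s = zblocks N t.
Proof. by move=> /permP st; apply: eq_bigr => b _; rewrite st. Qed.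

Lemma zblocks_cons N b s : b \in blocks N ->
  zblocks N (b :: s) = (zblocks N s * (b.2 * (count_mem b s).+1))%N.
Proof.
move=> bN; rewrite /zblocks !(bigD1_seq b) ?blocks_uniq //= eqxx add1n.
under eq_bigr => c /negPf cb do rewrite eq_sym cb add0n.
by rewrite expnS factS; lia.
Qed.

Lemma zblocks_gt0 N s : (0 < zblocks N s)%N.
Proof.
rewrite /zblocks big_seq prodn_cond_gt0 // => b; rewrite mem_blocks.
by case/andP=> /andP[_ b2] _; rewrite muln_gt0 expn_gt0 b2 fact_gt0.
Qed.

(** * The exponential recursion *)

(** The inverse bijection removes one copy of b from a type that contains it. *)
Lemma types_insert d b : positive_block b -> (block_size b <= d)%N ->
  perm_eq [seq r <- types d | b \in r]
          [seq sort block_ge (b :: r) | r <- types (d - block_size b)].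
Proof.
move=> pb bd; apply: uniq_perm.
- by rewrite filter_uniq ?types_uniq.
- rewrite map_inj_in_uniq ?types_uniq // => r s; rewrite !mem_types => hr hs.
  move=> /perm_sortP - /(_ block_ge_total block_ge_trans block_ge_anti).
  by rewrite perm_cons; apply: type_of_inj hr hs.
move=> r; rewrite mem_filter mem_types; apply/andP/mapP => [[br hr]|].
  have pr := perm_to_rem br; exists (rem b r).
    rewrite mem_types.
    have -> : rem b r = sort block_ge (rem b r).
      apply/esym/(sorted_sort block_ge_trans).
      by apply: (subseq_sorted block_ge_trans (rem_subseq b r)) (type_of_sorted hr).
    rewrite type_of_sort -(type_of_weight hr) (weight_perm pr) weight_cons addKn eqxx.
    by rewrite andbT; move: (type_of_positive hr); rewrite (perm_all _ pr) => /andP[].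
  rewrite -[LHS](sort_type hr).
  exact/(perm_sortP block_ge_total block_ge_trans block_ge_anti).
case=> s; rewrite mem_types => hs ->; rewrite mem_sort mem_head; split=> //.
rewrite type_of_sort /= pb (type_of_positive hs) weight_cons (type_of_weight hs).
by rewrite subnKC ?eqxx.
Qed.

Lemma weight_count d r : type_of d r ->
  (\sum_(b <- blocks d | (block_size b <= d) && (b \in r))
     count_mem b r * block_size b)%N = d.
Proof.
move=> hr; rewrite -[RHS](type_of_weight hr) /weight.
have rd b : b \in r -> b \in blocks d by apply: type_of_blocks hr (leqnn d).
transitivity (\sum_(b <- blocks d) \sum_(c <- r | c == b) block_size c)%N.
  rewrite big_mkcond /=; apply: eq_bigr => b _.
  rewrite (eq_bigr (fun=> block_size b)) => [|c /eqP-> //].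
  rewrite big_const_seq iter_addn_0 mulnC.
  case: ifP => // /negbT; rewrite negb_and => nb.
  case: (boolP (b \in r)) nb => [br|/count_memPn-> //]; last by rewrite muln0.
  by rewrite orbF -[X in (_ <= X)%N](type_of_weight hr) leq_block_size.
rewrite (exchange_big_dep predT) //= big_seq [RHS]big_seq; apply: eq_bigr => c cr.
rewrite (eq_bigl (fun b => b == c)) => [|b]; last by rewrite eq_sym.
by rewrite -big_filter filter_pred1_uniq ?blocks_uniq ?rd // big_seq1.
Qed.

(** The degree d part of the exponential of the sum over all blocks b of
    q b / b.2, where q b has degree block_size b. *)
Definition expsum (A : comAlgType rat) (q : block -> A) (d : nat) : A :=
  \sum_(r <- types d) (ztens r)%:R^-1 *: \prod_(b <- r) q b.

Lemma ztens_insert d b r : type_of d r -> positive_block b ->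
  ztens (sort block_ge (b :: r)) = (ztens r * (b.2 * (count_mem b r).+1))%N.
Proof.
move=> hr pb; set N := (block_size b + d)%N.
have hs : type_of N (sort block_ge (b :: r)).
  rewrite type_of_sort /= pb (type_of_positive hr) weight_cons.
  by rewrite (type_of_weight hr) eqxx.
rewrite (ztensE hs (leqnn N)) (ztensE hr (leq_addl _ _ : d <= N)%N) -zblocks_cons.
  by apply: zblocks_perm; rewrite perm_sort.
by apply: (type_of_blocks hs (leqnn _)); rewrite mem_sort mem_head.
Qed.

Lemma ztens_gt0 d r : type_of d r -> (0 < ztens r)%N.
Proof. by move=> hr; rewrite (ztensE hr (leqnn d)) zblocks_gt0. Qed.

(** Each term of the left-hand side is distributed over the distinct blocks of
    its type r, the block b receiving the fraction count_mem b r * block_size b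
    of the weight d; what b receives is, by [ztens_insert], b.1 times the term
    of r with b removed, times q b. *)
Lemma expsum_rec (A : comAlgType rat) (q : block -> A) d :
  d%:R *: expsum q d =
  \sum_(b <- blocks d | (block_size b <= d)%N)
     b.1%:R *: (q b * expsum q (d - block_size b)).
Proof.
pose t r : A := (ztens r)%:R^-1 *: \prod_(b <- r) q b.
transitivity (\sum_(b <- blocks d | (block_size b <= d)%N)
    \sum_(r <- types d | b \in r) (count_mem b r * block_size b)%:R *: t r).
  rewrite (exchange_big_dep predT) //= scaler_sumr big_seq [RHS]big_seq.
  apply: eq_bigr => r; rewrite mem_types => hr.
  by rewrite -scaler_suml -natr_sum weight_count.
rewrite big_seq_cond [RHS]big_seq_cond; apply: eq_bigr => b.
rewrite mem_blocks => /andP[/andP[pb _] bd].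
rewrite -big_filter (perm_big _ (types_insert pb bd)) big_map.
rewrite mulr_sumr scaler_sumr big_seq [RHS]big_seq; apply: eq_bigr => r.
rewrite mem_types => hr; rewrite /t (ztens_insert hr pb).
rewrite (perm_big _ (permEl (perm_sort _ _))) /= big_cons -scalerAr !scalerA.
congr (_ *: _); rewrite count_sort /= eqxx add1n /block_size !natrM.
have [b1 b2] := andP pb.
have z0 : (ztens r)%:R != 0 :> rat by rewrite Num.Theory.pnatr_eq0 -lt0n (ztens_gt0 hr).
have b20 : b.2%:R != 0 :> rat by rewrite Num.Theory.pnatr_eq0 -lt0n.
have c0 : 1 + (count_mem b r)%:R != 0 :> rat by rewrite addrC natr1 Num.Theory.pnatr_eq0.
by field; rewrite z0 c0.
Qed.

(** * Monomials *)

Lemma expcmE (m : mono) n v : expcmn m n v = (m v * n)%N.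
Proof.
rewrite /expcmn; case: n => [|n]; first by rewrite /= onecmE muln0.
rewrite iteropS; elim: n => [|n IH]; first by rewrite muln1.
by rewrite iterS mulcmE IH [in RHS]mulnS.
Qed.

Lemma degmE (D : {fset var}) (m : mono) : (finsupp m `<=` D)%fset ->
  degm m = (\sum_(v <- D) val v.1 * m v)%N.
Proof.
move=> le; rewrite /degm (big_fset_incl _ le) // => v _.
by rewrite -cmE_eq0 => /eqP->; rewrite muln0.
Qed.

Lemma degmM (a b : mono) : degm (mulcm a b) = (degm a + degm b)%N.
Proof.
have e : finsupp (mulcm a b) = (finsupp a `|` finsupp b)%fset by exact: mdomD.
rewrite /degm e -!/(degm _) (degmE (fsubsetUl _ (finsupp b))).
rewrite (degmE (fsubsetUr (finsupp a) _)) -big_split /=.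
by apply: eq_bigr => v _; rewrite mulcmE mulnDr.
Qed.

Lemma degm_var v r : degm (expcmn (ucm v) r) = (val v.1 * r)%N.
Proof.
rewrite (@degmE [fset v]%fset).
  by rewrite big_seq_fset1 expcmE ucmE eqxx mul1n.
apply/fsubsetP => w; rewrite -cmE_neq0 expcmE ucmE in_fset1.
by case: (v =P w) => [->|//]; rewrite eqxx.
Qed.

Lemma degm_eq0 (m : mono) : (degm m == 0%N) = (m == onecm var).
Proof.
apply/eqP/eqP => [m0|->]; last first.
  have := degmM (onecm var) (onecm var); rewrite mul0cm => /eqP.
  by rewrite -{1}[degm _]addn0 eqn_add2l eq_sym => /eqP.
apply/eqP/cmP => v; rewrite onecmE; apply/eqP; rewrite cmE_eq0; apply/negP => vm.
move: m0; rewrite /degm (big_fsetD1 v) //= => /eqP; rewrite addn_eq0 => /andP[+ _].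
rewrite muln_eq0 => /orP[/eqP v0|]; last by rewrite cmE_eq0 vm.
by have := svalP v.1; rewrite /= v0.
Qed.

(** Division of a monomial by a power of a variable, the only division of
    monomials that multiplication by a power sum calls for. *)
Lemma mulcm_divcm v r (m b : mono) :
  (mulcm (expcmn (ucm v) r) b == m) = (r <= m v)%N && (b == divcm m (expcmn (ucm v) r)).
Proof.
apply/eqP/andP => [<-|[rm /eqP->]].
  split; first by rewrite mulcmE expcmE ucmE eqxx mul1n leq_addr.
  by apply/eqP/eqP/cmP => w; rewrite divcmE mulcmE addKn.
apply/eqP/cmP => w; rewrite mulcmE divcmE expcmE ucmE subnKC //.
by case: eqP => [<-|//]; rewrite mul1n.
Qed.

(** * Products with a power sum *)

Lemma coef_mul f g m : coef (f * g) m =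
  \sum_(a <- mdivs m) \sum_(b <- mdivs m)
     (mulcm a b == m)%:R * (coef f a * coef g b).
Proof. exact: coef_mulE_mdivs. Qed.

Lemma coef_scale a f m : coef (a *: f) m = a * coef f m.
Proof. by []. Qed.

Lemma coef_bigsum (I : Type) (r : seq I) (P : pred I) (F : I -> series) m :
  coef (\sum_(i <- r | P i) F i) m = \sum_(i <- r | P i) coef (F i) m.
Proof. by apply: (big_morph (fun f => coef f m)). Qed.

Lemma series_scalerAl (a : rat) (f g : series) : a *: (f * g) = (a *: f) * g.
Proof.
apply: seriesP => m; rewrite coef_scale !coef_mul mulr_sumr; apply: eq_bigr => u _.
by rewrite mulr_sumr; apply: eq_bigr => v _; rewrite coef_scale; ring.
Qed.

(** The scalar and ring structures of series form an algebra, which is what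
    makes [expsum] available for series. *)
HB.instance Definition _ := GRing.Lmodule_isLalgebra.Build rat series series_scalerAl.
HB.instance Definition _ := GRing.Lalgebra_isComAlgebra.Build rat series.

Lemma expcmn_var_inj r : (0 < r)%N -> injective (fun v : var => expcmn (ucm v) r).
Proof.
move=> r0 v w /(congr1 (fun m : mono => m v)); rewrite !expcmE !ucmE eqxx mul1n.
by case: (w =P v) => // _ r00; rewrite r00 mul0n in r0.
Qed.

(** On monomials with variables in a finite set D, the infinite power sum is a
    finite sum over D. *)
Lemma coef_psum k r (D : {fset var}) (a : mono) : (0 < r)%N -> (finsupp a `<=` D)%fset ->
  coef (psum k r) a = \sum_(v <- D | val v.1 == k) (a == expcmn (ucm v) r)%:R.
Proof.
move=> r0 /fsubsetP aD; rewrite /psum /=; case: asboolP => [[v [vk av]]|no].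
  have vD : v \in D by apply: aD; rewrite av -cmE_neq0 expcmE ucmE eqxx mul1n -lt0n.
  rewrite big_mkcond (big_fsetD1 v) //= vk eqxx av eqxx big_seq big1 ?addr0 // => w.
  rewrite in_fsetD1 => /andP[wv _]; case: ifP => // _.
  by case: eqP => // /(expcmn_var_inj r0) vw; rewrite vw eqxx in wv.
rewrite big1 // => v /eqP vk; case: eqP => // av; case: no; by exists v.
Qed.

(** A monomial m is obtained from a power v^r and another monomial once for
    each variable v of degree k whose exponent in m is at least r. *)
Lemma coef_psumM k r f m : (0 < r)%N -> coef (psum k r * f) m =
  \sum_(v <- finsupp m | (val v.1 == k) && (r <= m v)%N)
     coef f (divcm m (expcmn (ucm v) r)).
Proof.
move=> r0; rewrite coef_mul.
transitivity (\sum_(a <- mdivs m) \sum_(b <- mdivs m)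
    \sum_(v <- finsupp m | val v.1 == k)
      (a == expcmn (ucm v) r)%:R * ((mulcm a b == m)%:R * coef f b)).
  apply: eq_bigr => a _; apply: eq_bigr => b _.
  case: eqP => [abm|_]; last by rewrite mul0r big1 // => v _; rewrite mul0r mulr0.
  rewrite (@coef_psum k r (finsupp m)) // ?mul1r ?mulr_suml //.
  apply/fsubsetP => v; rewrite -!cmE_neq0 -abm mulcmE -!lt0n => av.
  by rewrite addn_gt0 av.
rewrite (eq_bigr (fun a => \sum_(v <- finsupp m | val v.1 == k)
   \sum_(b <- mdivs m) (a == expcmn (ucm v) r)%:R * ((mulcm a b == m)%:R * coef f b)));
  last by move=> a _; rewrite exchange_big.
rewrite exchange_big /= big_mkcondr /=; apply: eq_bigr => v vk.
set x := expcmn _ r; set y := divcm m x; have xb := mulcm_divcm v r m.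
transitivity (\sum_(a <- mdivs m) (a == x)%:R *
   \sum_(b <- mdivs m) (mulcm a b == m)%:R * coef f b).
  by apply: eq_bigr => a _; rewrite mulr_sumr.
case: ifP => rm; last first.
  rewrite big1 // => a _; case: eqP => [->|_]; last by rewrite mul0r.
  by rewrite mul1r big1 // => b _; rewrite xb rm mul0r.
have xy : mulcm x y = m by apply/eqP; rewrite xb rm eqxx.
rewrite (bigD1_seq x) ?mdivs_uniq ?(mem_mdivsl xy) //= eqxx mul1r.
rewrite [X in _ + X]big1 => [|a /negPf->]; last by rewrite mul0r.
rewrite addr0 (bigD1_seq y) ?mdivs_uniq ?(mem_mdivsr xy) //= xy eqxx mul1r.
by rewrite big1 ?addr0 // => b /negPf nb; rewrite xb rm nb mul0r.
Qed.

(** * The series H_d *)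

Definition power_mono (e : nat) (m : mono) : bool := `[< forall v, (e %| m v)%N >].

(** Taking e-th powers is injective on monomials and multiplies the degree by
    e, so every coefficient of H_{d^e} is 0 or 1. *)
Lemma coef_Hpow e d m : (0 < e)%N ->
  coef (subst_pow e (Hdeg d)) m = (power_mono e m && (degm m == d * e)%N)%:R.
Proof.
move=> e0; rewrite /subst_pow /=; case: (boolP (power_mono e m)) => [/asboolP em|nem].
  (* The e-th root of m. *)
  pose u : mono := [cmonom m v %/ e | v in finsupp m]%M.
  have uE v : u v = (m v %/ e)%N.
    rewrite cmE fsfun_fun; case: ifP => // /negbT; rewrite -cmE_eq0 => /eqP->.
    by rewrite div0n.
  have um : expcmn u e = m by apply/eqP/cmP => v; rewrite expcmE uE divnK.
  rewrite (_ : [set _ | _]%classic = [set u]%classic); last first.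
    apply/seteqP; split=> [w /= wm|w /= ->] //; apply/eqP/cmP => v.
    by rewrite uE -wm expcmE mulnK.
  have mu : degm m = (degm u * e)%N.
    rewrite (@degmE (finsupp m) u) ?big_distrl /=.
      by apply: eq_bigr => v _; rewrite -[in LHS]um expcmE mulnA.
    apply/fsubsetP => v; rewrite -!cmE_neq0 -[in X in _ -> X]um expcmE muln_eq0.
    by move=> /negPf->; rewrite -lt0n.
  by rewrite fsbig_set1 /= mu eqn_pmul2r.
rewrite (_ : [set _ | _]%classic = set0) ?fsbig_set0 //.
apply/seteqP; split=> w //= wm; case/asboolP: nem => v.
by rewrite -wm expcmE dvdn_mull.
Qed.

Lemma power_mono_div e (v : var) l (m : mono) : (e * l <= m v)%N ->
  power_mono e (divcm m (expcmn (ucm v) (e * l))) = power_mono e m.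
Proof.
move=> le; have mE w : m w = ((v == w) * (e * l) + divcm m (expcmn (ucm v) (e * l)) w)%N.
  by rewrite divcmE expcmE ucmE subnKC //; case: eqP => [<-|//]; rewrite mul1n.
apply/asboolP/asboolP => em w; last first.
  by have := em w; rewrite mE dvdn_addr // dvdn_mull // dvdn_mulr.
by rewrite mE dvdn_addr ?em // dvdn_mull // dvdn_mulr.
Qed.

(** A variable of degree k and exponent e * q contributes to the recursion once
    for each l <= q, by the block k^l. *)
Lemma sum_blocks_var d k q : (k * q <= d)%N -> (0 < k)%N ->
  \sum_(b <- blocks d | (block_size b <= d)%N && ((k == b.1) && (b.2 <= q)%N)) b.1 =
    (k * q)%N.
Proof.
move=> kqd k0; rewrite -big_filter (perm_big [seq (k, l) | l <- index_iota 1 q.+1]).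
  by rewrite big_map /= sum_nat_const_nat subn1 mulnC.
apply: uniq_perm; first by rewrite filter_uniq ?blocks_uniq.
  by rewrite map_inj_uniq ?iota_uniq // => l l' [].
case=> k' l; rewrite mem_filter mem_blocks /block_size /=; apply/idP/mapP.
  case/andP=> /and3P[_ /eqP <- lq] /and3P[/andP[_ l0] _ _].
  by exists l; rewrite // mem_index_iota ltnS; apply/andP.
case=> l'; rewrite mem_index_iota ltnS => /andP[l0 lq] [-> ->].
rewrite eqxx /positive_block /= k0 l0 lq !andbT /=.
have kl : (k * l' <= d)%N by rewrite (leq_trans _ kqd) // leq_mul2l lq orbT.
rewrite kl /=; apply/andP; split; apply: leq_trans kl; first by rewrite leq_pmulr.
by rewrite leq_pmull.
Qed.

(** Both sides vanish at m unless m is an e-th power of degree d * e. In that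
    case a variable v of exponent e * q in m can be split off as v^(e l) for
    l = 1, ..., q, so that v contributes deg v * q to the right-hand side; the
    sum of these numbers is degm m / e = d. *)
Lemma Hpow_rec e d : (0 < e)%N ->
  d%:R *: subst_pow e (Hdeg d) =
  \sum_(b <- blocks d | (block_size b <= d)%N)
     b.1%:R *: (psum b.1 (e * b.2) * subst_pow e (Hdeg (d - block_size b))).
Proof.
move=> e0; apply: seriesP => m; rewrite coef_bigsum coef_scale coef_Hpow //.
set P := power_mono e m && _.
transitivity (\sum_(b <- blocks d | (block_size b <= d)%N)
   (b.1 * \sum_(v <- finsupp m | (val v.1 == b.1) && (e * b.2 <= m v)%N) P)%:R : rat);
  last first.
  rewrite big_seq_cond [RHS]big_seq_cond; apply: eq_bigr => b.
  rewrite mem_blocks => /andP[/andP[/andP[b1 b2] _] bd].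
  rewrite coef_scale coef_psumM ?muln_gt0 ?e0 // natrM natr_sum; congr (_ * _).
  apply: eq_bigr => v /andP[/eqP vb em].
  rewrite coef_Hpow // power_mono_div // /P; congr (_ && _)%:R.
  set x := expcmn (ucm v) (e * b.2).
  have /eqP mE : mulcm x (divcm m x) == m by rewrite mulcm_divcm em eqxx.
  rewrite -[in LHS]mE degmM degm_var vb.
  have -> : (d * e = b.1 * (e * b.2) + (d - block_size b) * e)%N.
    by rewrite mulnBl mulnCA [(e * _)%N]mulnC subnKC // leq_mul2r bd orbT.
  by rewrite eqn_add2l.
rewrite -natr_sum -natrM; congr _%:R.
case: (boolP P) => [/andP[em /eqP md]|_]; last first.
  by rewrite muln0 big1 // => b _; rewrite big1 // muln0.
rewrite muln1; under eq_bigr do rewrite big_distrr /=.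
rewrite (exchange_big_dep predT) //= -[LHS](mulnK _ e0) -md /degm.
transitivity (\sum_(v <- finsupp m) (val v.1 * (m v %/ e)))%N.
  rewrite -[RHS](mulnK _ e0); congr (_ %/ _)%N; rewrite big_distrl /=.
  by apply: eq_bigr => v _; rewrite -mulnA divnK //; move/asboolP: em.
rewrite big_seq [RHS]big_seq; apply: eq_bigr => v vm.
rewrite -(@sum_blocks_var d) ?(valP v.1) //.
  by apply: eq_big => [b|b _]; rewrite ?muln1 // leq_divRL // mulnC.
rewrite -(leq_pmul2r e0) -md /degm (big_fsetD1 v) //= -mulnA divnK ?leq_addr //.
by move/asboolP: em.
Qed.

Lemma types0 : types 0 = [:: [::]].
Proof. by rewrite /types /= /type_of /weight big_nil. Qed.

(** The expansion of H_{d^e}: the recursion determines the series of index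
    d > 0 from those of smaller index, because d is invertible. *)
Lemma Hpow_expsum e d : (0 < e)%N ->
  subst_pow e (Hdeg d) = expsum (fun b => psum b.1 (e * b.2)) d.
Proof.
move=> e0; elim/ltn_ind: d => -[_|d IH].
  rewrite /expsum types0 big_seq1 big_nil.
  rewrite (_ : ztens [::] = 1%N); last by rewrite /ztens /weight big_nil big_geq.
  apply: seriesP => m; rewrite invr1 scale1r coef_Hpow // mul0n degm_eq0 /=.
  congr (nat_of_bool _)%:R; case: eqP => [->|_]; last by rewrite andbF.
  by rewrite andbT; apply/asboolP => v; rewrite onecmE.
have d0 : d.+1%:R != 0 :> rat by rewrite Num.Theory.pnatr_eq0.
apply: (scalerI d0); rewrite Hpow_rec // expsum_rec.
rewrite big_seq_cond [RHS]big_seq_cond; apply: eq_bigr => b.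
rewrite mem_blocks => /andP[/andP[/andP[b1 b2] _] bd].
by rewrite IH // ltn_subrL muln_gt0 b1 b2.
Qed.

(** * Linear independence *)

Lemma ptensE n t : type_of n t -> ptens t = \prod_(b <- t) psum b.1 b.2.
Proof.
move=> ht; rewrite /ptens (type_of_weight ht).
transitivity (\prod_(1 <= k < n.+1) \prod_(b <- t | b.1 == k) psum b.1 b.2).
  apply: eq_bigr => k _; rewrite big_map big_filter.
  by apply: eq_bigr => b /eqP->.
rewrite (exchange_big_dep predT) //= big_seq [RHS]big_seq; apply: eq_bigr => b bt.
have := type_of_blocks ht (leqnn n) bt; rewrite mem_blocks => /and3P[/andP[b1 _] bn _].
rewrite (eq_bigl (fun k => k == b.1)) => [|k]; last by rewrite eq_sym.
by rewrite -big_filter filter_pred1_uniq ?iota_uniq ?mem_index_iota ?b1 // big_seq1.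
Qed.

(** A power v^r of a variable, encoded as the pair (v, r), is one of the terms
    of p_{k,r}, where k is the degree of v. *)
Definition block_of (p : var * nat) : block := (val p.1.1, p.2).

Definition monomial_of (l : seq (var * nat)) : mono :=
  foldr (fun p => mulcm (expcmn (ucm p.1) p.2)) (onecm var) l.

Lemma monomial_ofE l v : monomial_of l v = (\sum_(p <- l | p.1 == v) p.2)%N.
Proof.
elim: l => [|p l IH]; first by rewrite big_nil onecmE.
rewrite [LHS]/= mulcmE IH expcmE ucmE big_cons.
by case: ifP => _; rewrite ?mul1n.
Qed.

Lemma mem_monomial_of l p : uniq (unzip1 l) ->
  (p \in l) = (p.1 \in unzip1 l) && (monomial_of l p.1 == p.2).
Proof.
elim: l => //= q l IH /andP[ql ul]; rewrite !in_cons mulcmE expcmE ucmE.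
case: (q.1 =P p.1) => [qp|qp].
  rewrite eq_sym qp eqxx mul1n /= (_ : monomial_of l p.1 = 0%N).
    have pl : p \in l = false by apply: contraNF ql => pl; rewrite qp map_f.
    rewrite pl orbF addn0 [p]surjective_pairing [q]surjective_pairing.
    by rewrite xpair_eqE qp eqxx.
  rewrite monomial_ofE big_seq_cond big1 // => r /andP[rl /eqP rp].
  by case/negP: ql; rewrite qp -rp map_f.
rewrite mul0n add0n IH // (_ : p == q = false) 1?(_ : p.1 == q.1 = false) //.
  by apply/eqP => pq; apply: qp.
by apply/eqP => pq; apply: qp; rewrite pq.
Qed.

(** Multiplying powers of distinct variables produces a monomial that cannot be
    obtained with fewer factors, and with as many factors only from the same
    powers: every variable of the monomial must occur among the factors. *)
Lemma monomial_of_blocks l l' : uniq (unzip1 l) ->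
  all positive_block (map block_of l) -> (size l' <= size l)%N ->
  monomial_of l' = monomial_of l -> perm_eq (map block_of l) (map block_of l').
Proof.
move=> ul pl sl ll'; apply: perm_map.
have sub : {subset unzip1 l <= unzip1 l'}.
  move=> v /mapP[p pl0 ->]; apply/negPn/negP => np.
  have : monomial_of l p.1 == p.2 by move: pl0; rewrite mem_monomial_of // => /andP[].
  rewrite -ll' monomial_ofE big_seq_cond big1 => [/eqP p0|q /andP[ql /eqP qp]].
    by have /andP[_] := allP pl _ (map_f block_of pl0); rewrite /= -p0.
  by case/negP: np; rewrite -qp map_f.
have sl1 : (size (unzip1 l') <= size (unzip1 l))%N by rewrite !size_map.
have ul' := leq_size_uniq ul sub sl1.
have [_ ll] := uniq_min_size ul sub sl1.
apply: uniq_perm; [exact: map_uniq ul | exact: map_uniq ul' | move=> p].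
by rewrite !mem_monomial_of // ll ll'.
Qed.

(** There are infinitely many variables of every degree, so that the blocks of
    s can be given distinct variables; the second index of the variable counts
    the blocks. *)
Lemma distinct_vars s : all positive_block s ->
  exists2 l, map block_of l = s & uniq (unzip1 l).
Proof.
suff gen : all positive_block s -> exists l, [/\ map block_of l = s, uniq (unzip1 l)
    & all (fun p : var * nat => (val p.1.2 <= size s)%N) l].
  by case/gen=> l [? ? _]; exists l.
elim: s => [_|[k r] s IH /andP[/andP[k0 r0] /IH [l [ls ul bl]]]]; first by exists [::].
pose v : var := (Sub k k0, Sub (size s).+1 isT).
exists ((v, r) :: l); split => /=; first by rewrite ls.
  rewrite ul andbT; apply/mapP => -[p /(allP bl)] /= + vp.
  by rewrite -vp /= ltnn.
by rewrite leqnn; apply: sub_all bl => p; apply: leqW.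
Qed.

Lemma coef_prod_neq0 s m : coef (\prod_(b <- s) psum b.1 b.2) m != 0 ->
  exists2 l, map block_of l = s & m = monomial_of l.
Proof.
elim: s m => [|b s IH] m.
  rewrite big_nil /=; case: (m =P onecm var) => [-> _|]; last by rewrite eqxx.
  by exists [::].
rewrite big_cons coef_mul => h.
have [a [c [ac ba sc]]] : exists a c, [/\ mulcm a c = m, coef (psum b.1 b.2) a != 0
    & coef (\prod_(b <- s) psum b.1 b.2) c != 0].
  apply: contrapT => no; case/negP: h; apply/eqP; rewrite big1 // => a _.
  rewrite big1 // => c _; case: eqP => [ac|]; last by rewrite mul0r.
  rewrite mul1r; apply/eqP; apply: contrapT => /negP; rewrite mulf_eq0 negb_or.
  by case/andP=> ? ?; apply: no; exists a, c.
have [l ls cl] := IH _ sc.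
move: ba; rewrite /psum /=; case: asboolP => [[v [vk av]] _|]; last by rewrite eqxx.
exists ((v, b.2) :: l) => /=; last by rewrite -ac av cl.
by rewrite ls /block_of /= vk -surjective_pairing.
Qed.

Lemma coef_prod_ge0 s m : 0 <= coef (\prod_(b <- s) psum b.1 b.2) m.
Proof.
elim: s m => [|b s IH] m; first by rewrite big_nil Num.Theory.ler0n.
rewrite big_cons coef_mul; apply: Num.Theory.sumr_ge0 => a _.
apply: Num.Theory.sumr_ge0 => c _; rewrite Num.Theory.mulr_ge0 ?Num.Theory.ler0n //.
by rewrite Num.Theory.mulr_ge0 // Num.Theory.ler0n.
Qed.

Lemma coef_prod_gt0 l :
  0 < coef (\prod_(b <- map block_of l) psum b.1 b.2) (monomial_of l).
Proof.
elim: l => [|p l IH]; first by rewrite big_nil /= eqxx.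
rewrite map_cons big_cons coef_mul.
set x := expcmn (ucm p.1) p.2.
have e : mulcm x (monomial_of l) = monomial_of (p :: l) by [].
have ge0 a c : 0 <= (mulcm a c == monomial_of (p :: l))%:R *
    (coef (psum (block_of p).1 (block_of p).2) a *
     coef (\prod_(b <- map block_of l) psum b.1 b.2) c).
  by rewrite !Num.Theory.mulr_ge0 ?coef_prod_ge0 ?Num.Theory.ler0n.
rewrite (bigD1_seq x) ?mdivs_uniq ?(mem_mdivsl e) //=.
rewrite (bigD1_seq (monomial_of l)) ?mdivs_uniq ?(mem_mdivsr e) //=.
rewrite -addrA Num.Theory.ltr_pwDl //; last first.
  rewrite Num.Theory.addr_ge0 // Num.Theory.sumr_ge0 // => a _.
  by rewrite Num.Theory.sumr_ge0.
rewrite eqxx mul1r Num.Theory.mulr_gt0 //.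
by rewrite asboolT // ; exists p.1.
Qed.

(** Downward induction on the number of blocks of t: let m be the product of
    powers of distinct variables, one for each block of t. By
    [monomial_of_blocks], m occurs in p_t' only if t' = t or t' has more blocks
    than t, and in the latter case c t' is already known to vanish. Hence the
    coefficient of m in the sum is c t times a positive number. *)
Lemma ptens_free n (c : seq block -> rat) :
  \sum_(t <- types n) c t *: ptens t = 0 -> forall t, type_of n t -> c t = 0.
Proof.
move=> sum0 t; move: {2}(n - size t)%N (erefl (n - size t)%N) => k.
elim/ltn_ind: k t => k IH t kE ht; have [l lt ul] := distinct_vars (type_of_positive ht).
have := congr1 (fun f => coef f (monomial_of l)) sum0.
rewrite coef_bigsum (bigD1_seq t) ?types_uniq ?mem_types //=.
rewrite big_seq_cond big1 => [|t']; last first.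
  rewrite mem_types => /andP[ht' tt']; case: (ltnP (size t) (size t')) => [lt_tt'|le_tt'].
    rewrite (IH (n - size t')%N) ?mul0r // -kE ltn_sub2l // (leq_trans lt_tt') //.
    by rewrite -(type_of_weight ht') size_le_weight // (type_of_positive ht').
  rewrite (ptensE ht'); apply/eqP; apply: contraNT tt'.
  rewrite mulf_eq0 negb_or => /andP[_ /coef_prod_neq0 [l' lt' ll']].
  have sl : (size l' <= size l)%N.
    by rewrite -(size_map block_of l) lt -(size_map block_of l') lt'.
  have := monomial_of_blocks ul _ sl (esym ll'); rewrite lt lt' => tt.
  by apply/eqP/(type_of_inj ht' ht); rewrite perm_sym tt // (type_of_positive ht).
rewrite addr0 (ptensE ht) => /eqP; rewrite mulf_eq0 => /orP[/eqP //|].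
by have := coef_prod_gt0 l; rewrite lt Num.Theory.lt0r => /andP[/negPf->].
Qed.

(** * The expansion of a product of H's *)

(** The factors of H_sigma are sums over types of different weights; to expand
    the product these index sets have to lie in one finite type. *)
Definition all_types (n : nat) := flatten [seq types d | d <- iota 0 n.+1].

Lemma mem_all_types n d t : (d <= n)%N -> type_of d t -> t \in all_types n.
Proof.
move=> dn dt; apply/flattenP; exists (types d); last by rewrite mem_types.
by apply: map_f; rewrite mem_iota.
Qed.

Lemma perm_types n d : (d <= n)%N ->
  perm_eq (types d)
          [seq val j | j <- index_enum (seq_sub (all_types n)) & type_of d (val j)].
Proof.
move=> dn; apply: uniq_perm; first exact: types_uniq.
  by rewrite map_inj_uniq ?filter_uniq ?index_enum_uniq //; apply: val_inj.
move=> t; rewrite mem_types; apply/idP/mapP => [dt|[j + ->]].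
  exists (SeqSub (mem_all_types dn dt)) => //.
  by rewrite mem_filter /= dt mem_index_enum.
by rewrite mem_filter => /andP[].
Qed.

Definition scale_mult (e : nat) (t : seq block) : seq block :=
  [seq (b.1, (e * b.2)%N) | b <- t].

Lemma weight_scale e t : weight (scale_mult e t) = (e * weight t)%N.
Proof.
rewrite /weight big_map /= big_distrr /=; apply: eq_bigr => b _; exact: mulnCA.
Qed.

Section Assignments.
Variables (n : nat) (sigma : seq block).

(** A choice of a type rho_i for every block of sigma. *)
Definition assignment := {ffun 'I_(size sigma) -> seq_sub (all_types n)}.

Implicit Type f : assignment.

Definition admissible f :=
  [forall i, type_of (tnth (in_tuple sigma) i).1 (val (f i))].

(** The blocks of all the m_i rho_i; they are not sorted. *)
Definition assembled f : seq block :=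
  flatten [seq scale_mult (tnth (in_tuple sigma) i).2 (val (f i))
          | i <- index_enum 'I_(size sigma)].

Definition assignment_wt f : rat := \prod_i (1 / (ztens (val (f i)))%:R).

Hypothesis sigman : type_of n sigma.

Lemma positive_tnth i : positive_block (tnth (in_tuple sigma) i).
Proof. by apply: (allP (type_of_positive sigman)); apply: mem_tnth. Qed.

Lemma Htype_assignments :
  Htype sigma = \sum_(f | admissible f)
     assignment_wt f *: \prod_(b <- assembled f) psum b.1 b.2.
Proof.
rewrite /Htype big_tnth.
pose F i (j : seq_sub (all_types n)) : series := (1 / (ztens (val j))%:R) *:
  \prod_(b <- scale_mult (tnth (in_tuple sigma) i).2 (val j)) psum b.1 b.2.
transitivity (\prod_(i < size sigma)
    \sum_(j : seq_sub (all_types n) | type_of (tnth (in_tuple sigma) i).1 (val j)) F i j).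
  apply: eq_bigr => i _; have /andP[i1 i2] := positive_tnth i.
  rewrite Hpow_expsum // /expsum (perm_big _ (@perm_types n _ _)) /=; last first.
    rewrite -(type_of_weight sigman).
    apply: leq_trans (leq_block_size (mem_tnth i (in_tuple sigma))).
    by have /andP[] := positive_block_le (positive_tnth i).
  rewrite big_map big_filter; apply: eq_bigr => j _; rewrite /F div1r; congr (_ *: _).
  by rewrite big_map.
rewrite bigA_distr_big_dep; apply: eq_big => [f|f _].
  by apply/familyP/forallP.
by rewrite scaler_prod /assembled big_flatten big_map.
Qed.

Lemma assembled_type f : admissible f -> type_of n (sort block_ge (assembled f)).
Proof.
move=> /forallP fa; rewrite type_of_sort; apply/andP; split.
  apply/allP => b /flattenP[_ /mapP[i _ ->]] /mapP[c cf ->].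
  have /andP[_ i2] := positive_tnth i.
  have /andP[c1 c2] := allP (type_of_positive (fa i)) _ cf.
  by rewrite /positive_block /= c1 muln_gt0 i2.
rewrite -[X in _ == X](type_of_weight sigman) /weight big_flatten big_map.
rewrite [X in _ == X]big_tnth; apply/eqP/eq_bigr => i _.
by rewrite -/(weight _) weight_scale (type_of_weight (fa i)) mulnC.
Qed.

Lemma pexpansionE g c :
  is_pexpansion n g c <-> g = \sum_(t <- types n) c t *: ptens t.
Proof.
rewrite /is_pexpansion (fsbigE (types n)) ?types_uniq //.
- rewrite [X in _ = X <-> _]big_seq_cond [X in _ <-> _ = X]big_seq_cond.
  rewrite [X in _ = X <-> _](eq_bigl (fun t => (t \in types n) && true)) // => t.
  by rewrite andbT mem_types; case: (boolP (type_of n t)) => //= ht; rewrite mem_set.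
- by move=> t /=; rewrite mem_types.
- by move=> t /= ht; rewrite mem_types ht.
Qed.

(** Grouping the assignments by the type that they assemble to gives one
    expansion of H_sigma, and linear independence identifies it with the chosen
    one. *)
Lemma transHpE tau : type_of n tau ->
  transHp n tau sigma =
  \sum_(f | admissible f && perm_eq (assembled f) tau) assignment_wt f.
Proof.
move=> taun.
pose c t := \sum_(f | admissible f && perm_eq (assembled f) t) assignment_wt f.
have Hc : Htype sigma = \sum_(t <- types n) c t *: ptens t.
  rewrite Htype_assignments; symmetry.
  under eq_bigr do rewrite scaler_suml.
  rewrite (exchange_big_dep admissible) /=; last by move=> t f _ /andP[].
  apply: eq_bigr => f fa; have hs := assembled_type fa.
  rewrite fa -big_filter (perm_big [:: sort block_ge (assembled f)]).
    by rewrite big_seq1 (ptensE hs) (perm_big _ (permEl (perm_sort _ _))).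
  apply: uniq_perm; rewrite ?filter_uniq ?types_uniq // => t.
  rewrite mem_filter mem_types inE; apply/andP/eqP => [[ft ht]|->]; last first.
    by split=> //=; rewrite perm_sym perm_sort.
  by apply: (type_of_inj ht hs); rewrite perm_sym perm_sort.
rewrite /transHp; case: xgetP => [d _|/(_ c) no]; last by case: no; apply/pexpansionE.
move=> /pexpansionE Hd; apply/eqP; rewrite -subr_eq0; apply/eqP.
apply: (@ptens_free n (fun t => d t - c t)) taun.
under eq_bigr do rewrite scalerBl.
by rewrite sumrB -Hc -Hd subrr.
Qed.
End Assignments.

(** * Tableaux *)

Lemma perm_count_mem (T : eqType) (s t : seq T) :
  (forall x, count_mem x s = count_mem x t) -> perm_eq s t.
Proof. by move=> st; apply/allP => x _ /=; rewrite st. Qed.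

Lemma component_scale e t k :
  component (scale_mult e t) k = [seq (e * l)%N | l <- component t k].
Proof.
by rewrite /component /scale_mult filter_map -!map_comp.
Qed.

Lemma count_scale e k l t : (0 < e)%N ->
  count_mem (k, (e * l)%N) (scale_mult e t) = count_mem (k, l) t.
Proof.
move=> e0; rewrite count_map; apply: eq_count => -[a b] /=.
by rewrite !xpair_eqE eqn_pmul2l.
Qed.

(** This is why the content of a tableau determines the types rho_i. *)
Lemma scale_inj e m n s t : (0 < e)%N -> type_of m s -> type_of n t ->
  (forall k, (0 < k)%N ->
     perm_eq (component (scale_mult e s) k) (component (scale_mult e t) k)) -> s = t.
Proof.
move=> e0 hs ht st; apply: (type_of_inj hs ht); apply: perm_count_mem => -[k l].
(* Types have no blocks of degree 0. *)
case: (posnP k) => [->|k0]; last first.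
  by rewrite -!(count_scale k l _ e0) -!count_component; apply/permP/st.
have z d r : type_of d r -> count_mem (0%N, l) r = 0%N.
  by move=> hr; apply: count_memPn; apply/negP => /(allP (type_of_positive hr)).
by rewrite (z _ _ hs) (z _ _ ht).
Qed.

Lemma empty_type : type_of 0 [::].
Proof. by rewrite /type_of /weight big_nil. Qed.

Section TableauAssignment.
Variables (n : nat) (sigma tau : seq block).
Hypotheses (sigman : type_of n sigma) (taun : type_of n tau).
Implicit Types (T : filling tau sigma) (f : assignment n sigma).

Local Notation deg i := (tnth (in_tuple sigma) i).1.
Local Notation mult i := (tnth (in_tuple sigma) i).2.

Lemma mult_gt0 i : (0 < mult i)%N.
Proof. by have /andP[] := positive_tnth sigman i. Qed.

Lemma content_inj T i r r' : content T i r -> content T i r' -> r = r'.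
Proof.
case=> hr cr [hr' cr']; apply: (scale_inj (mult_gt0 i) hr hr') => k k0.
by rewrite !component_scale -(permPl (cr k k0)); apply: cr'.
Qed.

Lemma content_typeE T i r : content T i r -> content_type T i = r.
Proof. by move=> cr; apply: xget_unique => // r' /content_inj; apply. Qed.

Lemma content_typeP T i : T \in ICRHT tau sigma -> content T i (content_type T i).
Proof. by rewrite inE => /and3P[_ /asboolP cT _]; apply: xgetPex; apply: cT. Qed.

(** The empty type stands in where a filling has a content that is not a type
    of weight at most n, which does not happen for tableaux. *)
Definition tableau_assignment T : assignment n sigma :=
  [ffun i => insubd (SeqSub (mem_all_types (leq0n n) empty_type)) (content_type T i)].

Lemma deg_le i : (deg i <= n)%N.
Proof.
rewrite -(type_of_weight sigman).
apply: leq_trans (leq_block_size (mem_tnth i (in_tuple sigma))).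
by have /andP[] := positive_block_le (positive_tnth sigman i).
Qed.

Lemma tableau_assignmentE T i r : content T i r -> val (tableau_assignment T i) = r.
Proof.
move=> cr; rewrite ffunE (content_typeE cr) insubdK //.
exact: mem_all_types (deg_le i) cr.1.
Qed.

Lemma tableau_assignmentP T i : T \in ICRHT tau sigma ->
  content T i (val (tableau_assignment T i)).
Proof. by move=> /(content_typeP i) cT; rewrite (tableau_assignmentE cT). Qed.

Lemma wt_assignment T : T \in ICRHT tau sigma ->
  assignment_wt (tableau_assignment T) = wt T.
Proof.
move=> hT; apply: eq_bigr => i _.
by rewrite (tableau_assignmentE (content_typeP i hT)).
Qed.

Lemma mem_tdiagram k r c : (((k, r), c) \in tdiagram tau) =
  [&& k \in iota 1 (weight tau), (r < size (component tau k))%N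
    & (c < row_len tau (k, r))%N].
Proof.
apply/allpairsPdep/and3P => [[kr [c' [krt ct e]]]|[kw rk cl]].
  case/allpairsPdep: krt => k' [r' [kw rk krE]]; rewrite krE in e ct.
  case: e => -> -> ->; split=> //.
    by move: rk; rewrite mem_iota.
  by move: ct; rewrite mem_iota.
exists (k, r), c; split; rewrite ?mem_iota //.
by apply/allpairsPdep; exists k, r; split=> //; rewrite mem_iota.
Qed.

Lemma row_len_gt0 k r : (r < size (component tau k))%N -> (0 < row_len tau (k, r))%N.
Proof.
move=> rk; have : row_len tau (k, r) \in component tau k by apply: mem_nth.
case/mapP=> b; rewrite mem_filter => /andP[_ /(allP (type_of_positive taun))].
by case/andP=> _ ? ->.
Qed.

(** Rows are not empty, so that the label of a row can be read off its first
    cell. *)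
Lemma row_head k r : (r < size (component tau k))%N -> ((k, r), 0%N) \in tdiagram tau.
Proof.
move=> rk; rewrite mem_tdiagram rk row_len_gt0 // !andbT.
have : row_len tau (k, r) \in component tau k by apply: mem_nth.
case/mapP=> b; rewrite mem_filter => /andP[/eqP <- bt] _.
have := type_of_blocks taun (leqnn n) bt.
by rewrite mem_blocks mem_iota (type_of_weight taun) add1n ltnS => /and3P[/andP[-> _] ->].
Qed.

(** The entry of the first cell stands for the whole row when rows are
    constant. *)
Definition row_label T (k r : nat) : nat :=
  if insub ((k, r), 0%N) is Some x then T x : nat else 0.

Lemma row_labelS T k r (kr : ((k, r), 0%N) \in tdiagram tau) :
  row_label T k r = T (SeqSub kr).
Proof.
rewrite /row_label; case: insubP => [y _ yE|]; last by rewrite kr.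
by congr (nat_of_ord (T _)); apply: val_inj.
Qed.

Lemma row_labelE T x : constant_rows T ->
  T x = row_label T (row_of x).1 (row_of x).2 :> nat.
Proof.
case: x => -[[k r] c] kr; rewrite /row_of /= => /forallP cT.
have := kr; rewrite mem_tdiagram => /and3P[_ /row_head rk _].
have /forallP/(_ (SeqSub rk)) := cT (SeqSub kr).
by rewrite /row_of eqxx row_labelS => /eqP->.
Qed.

Lemma row_label_lt T k r :
  (r < size (component tau k))%N -> (row_label T k r < size sigma)%N.
Proof. by move=> /row_head rk; rewrite (row_labelS _ rk). Qed.

Lemma filledE T i k r : constant_rows T -> (r < size (component tau k))%N ->
  [forall x, (row_of x == (k, r)) ==> (T x == i)] = (row_label T k r == i).
Proof.
move=> cT rk; apply/forallP/eqP => [ai|li x].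
  have /implyP := ai (SeqSub (row_head rk)); rewrite /row_of /= eqxx => /(_ isT) /eqP <-.
  by rewrite (row_labelE _ cT).
apply/implyP => /eqP xkr; apply/eqP/val_inj.
by rewrite /= (row_labelE _ cT) xkr.
Qed.

(** The rows within which the labels of an increasing tableau are required to
    be weakly increasing. *)
Definition equal_rows (k l : nat) : seq nat :=
  [seq r <- iota 0 (size (component tau k)) | row_len tau (k, r) == l].

Definition label_seq T k l : seq nat := [seq row_label T k r | r <- equal_rows k l].

Lemma mem_equal_rows k l r :
  (r \in equal_rows k l) = (r < size (component tau k))%N && (row_len tau (k, r) == l).
Proof. by rewrite mem_filter mem_iota andbC. Qed.

Lemma size_equal_rows k l : size (equal_rows k l) = count_mem (k, l) tau.
Proof.
rewrite -count_component size_filter -[in RHS](mkseq_nth 0%N (component tau k)) count_map.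
exact: eq_count.
Qed.

Lemma equal_rows_sorted k l : sorted ltn (equal_rows k l).
Proof. by apply: sorted_filter (iota_ltn_sorted _ _) => ? ? ?; apply: ltn_trans. Qed.

Lemma count_filled_rows T i k l : constant_rows T ->
  count_mem l (filled_rows T i k) = count_mem (i : nat) (label_seq T k l).
Proof.
move=> cT; rewrite !count_map !count_filter; apply: eq_in_count => r.
by rewrite mem_iota => /= rk; rewrite filledE // andbC.
Qed.

Lemma label_seq_sorted T k l : increasing T -> sorted leq (label_seq T k l).
Proof.
move=> /forallP iT; rewrite (sorted_pairwise leq_trans) pairwise_map.
have := equal_rows_sorted k l; rewrite (sorted_pairwise ltn_trans).
apply: (sub_in_pairwise (P := mem (equal_rows k l))); last exact/allP.
move=> r r' /=; rewrite !mem_equal_rows => /andP[rk rl] /andP[rk' rl'] lt_rr'.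
have /forallP/(_ (SeqSub (row_head rk'))) := iT (SeqSub (row_head rk)).
rewrite /row_of /col_of /= (eqP rl) (eqP rl') !eqxx (ltnW lt_rr') /=.
by rewrite (row_labelS _ (row_head rk)) (row_labelS _ (row_head rk')).
Qed.

Lemma count_label_seq T k l (i : 'I_(size sigma)) : T \in ICRHT tau sigma -> (0 < k)%N ->
  count_mem (i : nat) (label_seq T k l) =
  count_mem (k, l) (scale_mult (mult i) (val (tableau_assignment T i))).
Proof.
move=> hT k0; have [_ cT] := tableau_assignmentP i hT.
rewrite -count_filled_rows; last by move: hT; rewrite inE => /and3P[].
by rewrite (permP (cT k k0)) -component_scale count_component.
Qed.

Lemma label_seq_lt T k l : all (fun j => j < size sigma)%N (label_seq T k l).
Proof.
apply/allP => _ /mapP[r + ->]; rewrite mem_equal_rows => /andP[rk _].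
exact: row_label_lt.
Qed.

(** The assignment fixes the number of occurrences of each label in each
    [label_seq], and a weakly increasing sequence is determined by these
    numbers. *)
Lemma tableau_assignment_inj : {in ICRHT tau sigma &, injective tableau_assignment}.
Proof.
move=> T T' hT hT' TT'.
have [cT iT] : constant_rows T /\ increasing T.
  by move: hT; rewrite inE => /and3P[].
have [cT' iT'] : constant_rows T' /\ increasing T'.
  by move: hT'; rewrite inE => /and3P[].
apply/ffunP => x; apply: val_inj; rewrite /= (row_labelE x cT) (row_labelE x cT').
case: x => -[[k r] c] /= + ; rewrite /row_of /= mem_tdiagram => /and3P[+ rk _].
rewrite mem_iota => /andP[k0 _].
have eqL : label_seq T k (row_len tau (k, r)) = label_seq T' k (row_len tau (k, r)).
  apply: (sorted_eq leq_trans anti_leq); rewrite ?label_seq_sorted //.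
  apply: perm_count_mem => j; case: (ltnP j (size sigma)) => js; last first.
    rewrite !(count_memPn _) //; apply/negP => /(allP (label_seq_lt _ _ _)).
      by rewrite ltnNge js.
    by rewrite ltnNge js.
  by rewrite -[j]/(nat_of_ord (Ordinal js)) !count_label_seq // TT'.
by move/eq_in_map: eqL; apply; rewrite mem_equal_rows rk eqxx.
Qed.

Lemma count_assembled f b :
  count_mem b (assembled f) = (\sum_i count_mem b (scale_mult (mult i) (val (f i))))%N.
Proof. by rewrite count_flatten -map_comp sumnE big_map. Qed.

(** The rows of length l in component k are partitioned by their labels. *)
Lemma perm_assembled T : T \in ICRHT tau sigma ->
  perm_eq (assembled (tableau_assignment T)) tau.
Proof.
move=> hT; have adm : admissible (tableau_assignment T).
  by apply/forallP => i; have [] := tableau_assignmentP i hT.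
apply: perm_count_mem => -[k l]; case: (posnP k) => [->|k0].
  rewrite !(count_memPn _) //; apply/negP.
    by move/(allP (type_of_positive taun)).
  have := type_of_positive (assembled_type sigman adm); rewrite all_sort.
  by move/allP => h /h.
rewrite count_assembled -size_equal_rows -(size_map (row_label T k)) -/(label_seq T k l).
under eq_bigr => i _ do rewrite -count_label_seq //.
rewrite -[RHS]sum1_size.
transitivity (\sum_(j <- label_seq T k l) \sum_(i < size sigma | j == i :> nat) 1)%N.
  rewrite (exchange_big_dep predT) //=; apply: eq_bigr => i _.
  by rewrite sum1_count; apply: eq_count => j /=.
rewrite big_seq [RHS]big_seq; apply: eq_bigr => j /(allP (label_seq_lt _ _ _)) js.
by rewrite (big_pred1 (Ordinal js)) // => i; rewrite eq_sym.
Qed.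

Section Construction.
Variable f : assignment n sigma.
Hypotheses (fa : admissible f) (ft : perm_eq (assembled f) tau).

(** The only labels of the rows of length l in component k, from the top down,
    that are compatible with both the counts prescribed by f and the order
    condition on tableaux. *)
Definition prescribed_labels k l : seq nat :=
  let m i := count_mem (k, l) (scale_mult (mult i) (val (f i))) in
  sort leq (flatten [seq nseq (m i) (i : nat) | i <- index_enum 'I_(size sigma)]).

Lemma count_prescribed_labels k l (i : 'I_(size sigma)) :
  count_mem (i : nat) (prescribed_labels k l) =
  count_mem (k, l) (scale_mult (mult i) (val (f i))).
Proof.
rewrite count_sort count_flatten -map_comp sumnE big_map (bigD1 i) //=.
rewrite count_nseq /= eqxx mul1n big1 ?addn0 // => j /negPf ji.
by rewrite count_nseq /= -[_ == _ :> nat]/(j == i) ji.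
Qed.

Lemma size_prescribed_labels k l : size (prescribed_labels k l) = size (equal_rows k l).
Proof.
rewrite size_sort size_flatten sumnE /shape -map_comp big_map size_equal_rows.
rewrite -(permP ft) count_assembled; apply: eq_bigr => i _ /=; exact: size_nseq.
Qed.

Definition prescribed_label k r : nat :=
  let l := row_len tau (k, r) in
  nth 0 (prescribed_labels k l) (index r (equal_rows k l)).

Lemma prescribed_label_lt k r :
  (r < size (component tau k))%N -> (prescribed_label k r < size sigma)%N.
Proof.
move=> rk; rewrite /prescribed_label; set l := row_len _ _.
have : nth 0 (prescribed_labels k l) (index r (equal_rows k l)) \in prescribed_labels k l.
  by rewrite mem_nth // size_prescribed_labels index_mem mem_equal_rows rk eqxx.
by rewrite mem_sort => /flattenP[_ /mapP[i _ ->]] /nseqP[-> _].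
Qed.

Lemma map_prescribed_label k l :
  [seq prescribed_label k r | r <- equal_rows k l] = prescribed_labels k l.
Proof.
apply: (@eq_from_nth _ 0%N); first by rewrite size_map size_prescribed_labels.
move=> j; rewrite size_map => js; rewrite (nth_map 0%N) //.
have := mem_nth 0%N js; rewrite mem_equal_rows /prescribed_label => /andP[_ /eqP->].
by rewrite index_uniq // filter_uniq // iota_uniq.
Qed.

Let cell_label_lt (x : seq_sub (tdiagram tau)) :
  (prescribed_label (row_of x).1 (row_of x).2 < size sigma)%N.
Proof.
apply: prescribed_label_lt; case: x => -[[k r] c] /=.
by rewrite /row_of mem_tdiagram => /and3P[].
Qed.

Definition prescribed_tableau : filling tau sigma :=
  [ffun x => Ordinal (cell_label_lt x)].

Lemma row_label_prescribed k r : (r < size (component tau k))%N ->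
  row_label prescribed_tableau k r = prescribed_label k r.
Proof. by move=> /row_head rk; rewrite (row_labelS _ rk) ffunE. Qed.

Lemma prescribed_constant_rows : constant_rows prescribed_tableau.
Proof.
apply/forallP => x; apply/forallP => y; apply/implyP => /eqP xy.
by apply/eqP/val_inj; rewrite !ffunE /= xy.
Qed.

Lemma prescribed_content i : content prescribed_tableau i (val (f i)).
Proof.
split; first exact: (forallP fa).
move=> k k0; rewrite -component_scale; apply: perm_count_mem => l.
rewrite count_filled_rows ?prescribed_constant_rows // count_component.
rewrite -count_prescribed_labels -map_prescribed_label; congr (count_mem _ _).
apply/eq_in_map => r; rewrite mem_equal_rows => /andP[rk _].
by rewrite row_label_prescribed.
Qed.

Lemma prescribed_increasing : increasing prescribed_tableau.
Proof.
apply/forallP => -[[[k r] c] xt]; apply/forallP => -[[[k' r'] c'] yt]; apply/implyP.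
rewrite /row_of /= => /and5P[/eqP kk' /eqP ll' rr' _ _]; rewrite !ffunE /row_of /=.
move: xt yt ll'; rewrite -{}kk' !mem_tdiagram => /and3P[_ rk _] /and3P[_ rk' _] ll'.
rewrite /prescribed_label -ll'; set l := row_len _ _.
have rR : r \in equal_rows k l by rewrite mem_equal_rows rk eqxx.
have rR' : r' \in equal_rows k l by rewrite mem_equal_rows rk' -ll' eqxx.
apply: (sorted_leq_nth leq_trans leqnn);
  rewrite ?inE ?size_prescribed_labels ?index_mem //.
  exact: (sort_sorted leq_total).
rewrite leqNgt; apply/negP => lt_r'r.
have := sorted_ltn_index ltn_trans (equal_rows_sorted k l) _ _ rR' rR lt_r'r.
by rewrite ltnNge rr'.
Qed.

Lemma prescribed_tableauP : prescribed_tableau \in ICRHT tau sigma.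
Proof.
rewrite inE prescribed_constant_rows prescribed_increasing andbT.
by apply/asboolP => i; exists (val (f i)); apply: prescribed_content.
Qed.

Lemma prescribed_tableauK : tableau_assignment prescribed_tableau = f.
Proof. by apply/ffunP => i; apply/val_inj/tableau_assignmentE/prescribed_content. Qed.

End Construction.

(** [tableau_assignment] is a bijection from the tableaux to the admissible
    assignments that assemble to tau, and it preserves weights. *)
Lemma sum_tableaux :
  \sum_(T in ICRHT tau sigma) wt T =
  \sum_(f : assignment n sigma | admissible f && perm_eq (assembled f) tau)
     assignment_wt f.
Proof.
under eq_bigr => T hT do rewrite -(wt_assignment hT).
rewrite -(big_imset _ tableau_assignment_inj) /=; apply: eq_bigl => f.
apply/imsetP/andP => [[T hT ->]|[fa ft]].
  split; last exact: perm_assembled.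
  by apply/forallP => i; have [] := tableau_assignmentP i hT.
by exists (prescribed_tableau ft); rewrite ?prescribed_tableauP ?prescribed_tableauK.
Qed.

End TableauAssignment.

Theorem corollary45 (n : nat) (sigma tau : seq block)
    (hsigma : type_of n sigma) (htau : type_of n tau) :
  transHp n tau sigma = \sum_(T in ICRHT tau sigma) wt T.
Proof. by rewrite (transHpE hsigma htau) (sum_tableaux hsigma htau). Qed.
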